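(* Let $p>3$ be a prime and consider the exterior algebra $E[h_{2,j},h_{3,j},h_{4,j}\mid j\in\mathbb{Z}/4]$ over $\mathbb{Z}/p$ with the differential $d$ (a graded derivation, all $h$'s of degree 1) determined by $d(h_{2,j})=0$, $d(h_{3,j})=0$, $d(h_{4,j})=-h_{2,j}h_{2,j+2}$ (indices mod 4). Its cohomology is the tensor product of $E[h_{3,j}\ (j\in\mathbb{Z}/4),\rho_0,\rho_1]$ and $\aleph$, where $\rho_0=h_{4,0}+h_{4,2}$, $\rho_1=h_{4,1}+h_{4,3}$, and $\aleph$ is the direct sum of the modules generated by the cohomology classes $$1;\ h_{2,j};\ e_j=h_{2,j}h_{2,j+1},\ g_j=h_{4,j}h_{2,j};\ h_{2,j}g_{j+1},\ h_{2,j}g_{j+2},\ h_{2,j}g_{j+3};\ g_jg_{j+1},\ e_jg_{j+2};\ h_{2,j}g_{j+1}g_{j+2};\ e_0g_2g_3$$ with $j\in\mathbb{Z}/4$. Moreover, the relations $h_{2,i}h_{2,i+2}=0$, $h_{2,i}g_{i+2}=h_{2,i+2}g_i$ and $h_{2,i}g_{i+2}g_{i+3}=h_{2,i+2}g_{i+3}g_i$ hold.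
   Context: This differential graded algebra is the part of the reduced first May $E_1$-term for the Hopf algebra $S(4,2)=\mathbb{Z}/p[t_2,t_3,\dots]/(t_s^{p^4}-t_s)$ generated by $h_{2,j},h_{3,j},h_{4,j}$, with the first May differential; only the algebraic description above is needed. *)

(* Defs.v *)
From HB Require Import structures.
From mathcomp Require Import all_boot all_algebra.


Unset Printing Implicit Defensive.
Import GRing.Theory.
Local Open Scope ring_scope.

Section ExteriorMay.
Variable p : nat.

(* Generators: (k, j) with k : 'I_3 encoding h_{k+2,j}, j : 'I_4 = Z/4. *)
Definition gen := ('I_3 * 'I_4)%type.

Definition gidx (x : gen) : nat := (4 * x.1 + x.2)%N.

(* Elements of the exterior algebra: coefficient functions on the basis of
   monomials e_S = s_1 s_2 ... s_k (s_1 < ... < s_k in gidx order), S a set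
   of generators. *)
Definition ext := {ffun {set gen} -> 'F_p}.

(* sign of e_S e_T = sgnST e_{S u T} for disjoint S, T *)
Definition sgnST (S T : {set gen}) : 'F_p :=
  (-1) ^+ #|[set st in setX S T | (gidx st.2 < gidx st.1)%N]|.

Definition mono (S : {set gen}) : ext := [ffun U => (U == S)%:R].

Definition eone : ext := mono set0.

Definition escale (c : 'F_p) (x : ext) : ext := [ffun U => c * x U].

Definition emul (x y : ext) : ext :=
  [ffun U => \sum_(S : {set gen}) \sum_(T : {set gen} |
      [disjoint S & T] && (S :|: T == U)) sgnST S T * x S * y T].

Definition hgen (k : 'I_3) (j : 'I_4) : ext := mono [set (k, j)].
Definition h2 (j : 'I_4) : ext := hgen 0 j.
Definition h3 (j : 'I_4) : ext := hgen 1 j.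
Definition h4 (j : 'I_4) : ext := hgen 2 j.

Definition dgen (s : gen) : ext :=
  if s.1 == 2 then - emul (h2 s.2) (h2 (s.2 + 2)) else 0.

(* d on a basis monomial, as forced by the graded Leibniz rule
   (all generators have degree 1, d(generator) has even degree 2):
   d(s_1...s_k) = sum_i (-1)^(i-1) d(s_i) s_1..^s_i..s_k *)
Definition dmono (S : {set gen}) : ext :=
  \sum_(s in S) escale ((-1) ^+ #|[set t in S | (gidx t < gidx s)%N]|)
                  (emul (dgen s) (mono (S :\ s))).

Definition dM (x : ext) : ext := \sum_(S : {set gen}) escale (x S) (dmono S).

Definition cohom_basis (I : finType) (b : I -> ext) : Prop :=
  [/\ forall i, dM (b i) = 0,
      forall c : I -> 'F_p, (exists y, \sum_i escale (c i) (b i) = dM y) -> forall i, c i = 0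
    & forall z, dM z = 0 -> exists (c : I -> 'F_p) (y : ext), z = \sum_i escale (c i) (b i) + dM y].

Definition coboundary (x : ext) : Prop := exists y, x = dM y.

Definition rho0 : ext := h4 0 + h4 2.
Definition rho1 : ext := h4 1 + h4 3.
Definition ee (j : 'I_4) : ext := emul (h2 j) (h2 (j + 1)).
Definition g (j : 'I_4) : ext := emul (h4 j) (h2 j).

Definition egen (i : 'I_6) : ext :=
  if (i < 4)%N then h3 (inZp i) else if i == 4 :> nat then rho0 else rho1.

Definition emon (Q : {set 'I_6}) : ext := foldr emul eone [seq egen i | i <- enum Q].

(* the listed generators of aleph (each distinct class listed once:
   h_{2,j} g_{j+2} only for j = 0, 1, since h_{2,j}g_{j+2} = h_{2,j+2}g_j) *)
Definition aleph : seq ext :=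
  [:: eone] ++
  [seq h2 j | j <- enum 'I_4] ++
  [seq ee j | j <- enum 'I_4] ++
  [seq g j | j <- enum 'I_4] ++
  [seq emul (h2 j) (g (j + 1)) | j <- enum 'I_4] ++
  [seq emul (h2 j) (g (j + 2)) | j <- [:: (0 : 'I_4); 1]] ++
  [seq emul (h2 j) (g (j + 3)) | j <- enum 'I_4] ++
  [seq emul (g j) (g (j + 1)) | j <- enum 'I_4] ++
  [seq emul (ee j) (g (j + 2)) | j <- enum 'I_4] ++
  [seq emul (emul (h2 j) (g (j + 1))) (g (j + 2)) | j <- enum 'I_4] ++
  [:: emul (emul (ee 0) (g 2)) (g 3)].

(* the family (E-monomial) * (aleph generator), indexing a basis of
   E[h3_j, rho0, rho1] (x) aleph *)
Definition ecfamily (x : {set 'I_6} * 'I_(size aleph)) : ext :=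
  emul (emon x.1) (nth eone aleph x.2).

End ExteriorMay.

(* Main.v *)
(* The complex is E[h_{3,j}, rho_0, rho_1] tensored with the two three-generator
   complexes E[h_{2,i}, h_{2,i+2}, h_{4,i}], i = 0, 1.  Each of the latter is the
   sum of six cohomology classes and of the acyclic pair h_{4,i}, d h_{4,i}, so
   the whole complex should have a basis made of the 64 * 36 listed cycles, of
   64 * 14 further elements u and of their differentials du, from which the
   cohomology can be read off.  Since 64 * (36 + 2 * 14) = 2^12 is the dimension
   of the exterior algebra, it is enough that these elements span.  Their span is
   stable under left multiplication by h_{3,j}, rho_0 and rho_1, which reduces
   the claim to expanding the 64 monomials in h_{2,j}, h_{4,0} and h_{4,1}; this
   and all other explicit identities are decided by computing with words in
   anticommuting letters. *)

Require Import Defs.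
From HB Require Import structures.
From mathcomp Require Import all_boot all_algebra.
Set Implicit Arguments.
Unset Strict Implicit.
Unset Printing Implicit Defensive.
Import GRing.Theory.
Local Open Scope ring_scope.

(** * Linear algebra *)

Lemma bilinear_assoc (F : pzRingType) (V : lmodType F) (I : finType)
    (e : I -> V) (c : V -> I -> F) (mul : V -> V -> V) :
    (forall x, x = \sum_i c x i *: e i) ->
    (forall x y z, mul (x + y) z = mul x z + mul y z) ->
    (forall x y z, mul x (y + z) = mul x y + mul x z) ->
    (forall a x y, mul (a *: x) y = a *: mul x y) ->
    (forall a x y, mul x (a *: y) = a *: mul x y) ->
    (forall i j k, mul (e i) (mul (e j) (e k)) = mul (mul (e i) (e j)) (e k)) ->
  associative mul.
Proof.
move=> eE mulDl mulDr mulZl mulZr mulA.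
have mul0x x : mul 0 x = 0 by rewrite -(scale0r 0) mulZl !scale0r.
have mulx0 x : mul x 0 = 0 by rewrite -(scale0r 0) mulZr !scale0r.
have sumL (f : I -> V) y : mul (\sum_i f i) y = \sum_i mul (f i) y.
  by apply: (big_morph (mul^~ y)) => // u v; rewrite mulDl.
have sumR (f : I -> V) x : mul x (\sum_i f i) = \sum_i mul x (f i).
  by apply: (big_morph (mul x)) => // u v; rewrite mulDr.
move=> x y z; rewrite (eE x) !sumL; apply: eq_bigr => i _; rewrite !mulZl.
congr (_ *: _); rewrite (eE y) sumL !sumR sumL; apply: eq_bigr => j _.
rewrite mulZl !mulZr mulZl; congr (_ *: _).
by rewrite (eE z) !sumR; apply: eq_bigr => k _; rewrite !mulZr mulA.
Qed.

(** Both sides are linear in [x]. Here [a] is an element of degree one and [b] plays the part of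
    [d a]. *)
Lemma leibniz_of_basis (F : pzRingType) (A : algType F) (I : finType)
    (e : I -> A) (c : A -> I -> F) (d : {linear A -> A}) (a b : A) :
    (forall x, x = \sum_i c x i *: e i) ->
    (forall i, d (a * e i) = b * e i - a * d (e i)) ->
  forall x, d (a * x) = b * x - a * d x.
Proof.
move=> eE dE x; rewrite (eE x) mulr_sumr !linear_sum /= !mulr_sumr -sumrB.
by apply: eq_bigr => i _; rewrite -!scalerAr !linearZ /= dE scalerBr -!scalerAr.
Qed.

Section Spanned.
Variables (F : pzRingType) (V : lmodType F) (I : Type) (b : I -> V).

(** An inductive span makes sense over an infinite index type, such as the pairs of words of
    [ey_family], and turns stability under an operator into an induction. *)
Inductive spanned : V -> Prop :=
| Spanned0 : spanned 0
| SpannedD x y : spanned x -> spanned y -> spanned (x + y)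
| SpannedZ c x : spanned x -> spanned (c *: x)
| SpannedB i : spanned (b i).

End Spanned.

Lemma spanned_trans (F : pzRingType) (V : lmodType F) (I J : Type)
    (b : I -> V) (c : J -> V) :
  (forall i, spanned c (b i)) -> forall x, spanned b x -> spanned c x.
Proof.
by move=> sb x; elim=> {x} *; [exact: Spanned0 | exact: SpannedD | exact: SpannedZ |].
Qed.

Lemma spanned_mull (F : pzRingType) (A : algType F) (a : A) (I J : Type)
    (b : I -> A) (c : J -> A) :
  (forall i, spanned c (a * b i)) -> forall x, spanned b x -> spanned c (a * x).
Proof.
move=> sb x; elim=> {x} [|x y _ sx _ sy|e x _ sx|//].
- by rewrite mulr0; apply: Spanned0.
- by rewrite mulrDr; apply: SpannedD.
- by rewrite -scalerAr; apply: SpannedZ.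
Qed.

Lemma spannedP (F : pzRingType) (V : lmodType F) (I : finType) (b : I -> V) x :
  spanned b x -> exists c : I -> F, x = \sum_i c i *: b i.
Proof.
elim=> {x} [|x y _ [c ->] _ [e ->]|a x _ [c ->]|i].
- by exists (fun=> 0); rewrite big1 // => i _; rewrite scale0r.
- exists (fun i => c i + e i); rewrite -big_split; apply: eq_bigr => i _.
  by rewrite scalerDl.
- exists (fun i => a * c i); rewrite scaler_sumr; apply: eq_bigr => i _.
  by rewrite scalerA.
- exists (fun j => (j == i)%:R); rewrite (bigD1 i) //= eqxx scale1r big1 ?addr0 //.
  by move=> j /negPf->; rewrite scale0r.
Qed.

Definition split_family (V I K : Type) (d : V -> V) (b : I -> V) (u : K -> V)
    (j : I + (K + K)) : V :=
  match j with inl i => b i | inr (inl k) => u k | inr (inr k) => d (u k) end.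

(** * Reading cohomology off a basis of cycles, cochains and their differentials *)

Section CohomologyBasis.
Variables (F : fieldType) (V : vectType F).

Lemma free_codomP (J : finType) (f : J -> V) (c : J -> F) :
  free (codom f) -> \sum_j c j *: f j = 0 -> forall j, c j = 0.
Proof.
move=> /(@freeP _ _ _ (codom_tuple f)) freef sum0 j.
rewrite -(enum_rankK j); apply: (freef (fun i => c (enum_val i))).
rewrite -[RHS]sum0 [RHS](reindex (fun i : 'I_#|J| => enum_val i)) /=; last first.
  by apply: onW_bij; exists enum_rank; [exact: enum_valK | exact: enum_rankK].
apply: eq_bigr => i _; congr (_ *: _).
by rewrite (nth_map (enum_val i)) -?cardE // -enum_val_nth.
Qed.

Variables (d : {linear V -> V}) (I K : finType) (b : I -> V) (u : K -> V).
Local Notation split_family := (split_family d b u).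

(* A spanning family no larger than the dimension is a basis, and on a basis of
   this shape the cohomology can be read off. *)
Lemma cohomology_basis :
    (forall x, d (d x) = 0) -> (forall i, d (b i) = 0) ->
    (forall x, spanned split_family x) -> (#|I| + (#|K| + #|K|) <= dim V)%N ->
  (forall c : I -> F, (exists y, \sum_i c i *: b i = d y) -> forall i, c i = 0) /\
  (forall z, d z = 0 -> exists (c : I -> F) (y : V), z = \sum_i c i *: b i + d y).
Proof.
move=> dd db spanV dimV.
have sumE (c : I + (K + K) -> F) : \sum_j c j *: split_family j =
    \sum_i c (inl i) *: b i
    + (\sum_k c (inr (inl k)) *: u k + \sum_k c (inr (inr k)) *: d (u k)).
  by rewrite !big_sumType.
have freef : free (codom split_family).
  rewrite /free eqn_leq dim_span size_codom !card_sum /=.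
  apply: leq_trans dimV _; rewrite -dimvf; apply: dimvS; apply/subvP => x _.
  elim: (spanV x) => [|y z _ yin _ zin|c y _ yin|j]; first exact: mem0v.
  - exact: memvD.
  - exact: memvZ.
  - by apply/memv_span/codom_f.
(* The differential forgets all coefficients except those of the [u k], which it moves to
   [d (u k)]. *)
have dE c : d (\sum_j c j *: split_family j) = \sum_k c (inr (inl k)) *: d (u k).
  rewrite sumE !linearD !linear_sum /= big1 => [|i _]; last first.
    by rewrite linearZ /= db scaler0.
  rewrite [X in _ + (_ + X)]big1 => [|k _]; last by rewrite linearZ /= dd scaler0.
  by rewrite add0r addr0; apply: eq_bigr => k _; rewrite linearZ.
split=> [c [y cy] i | z dz].
  have [a yE] := spannedP (spanV y).
  (* If [a] are the coordinates of [y], then [d y] is the sum of the [a (inr (inl k)) *: d (u k)].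
     Subtracting it gives a vanishing combination of the basis whose coefficients at the cycles are
     those of [c]. *)
  pose e (j : I + (K + K)) := match j with
    inl i => c i | inr (inl k) => 0 | inr (inr k) => - a (inr (inl k)) end.
  apply: (free_codomP (c := e) freef _ (inl i)).
  rewrite sumE /= [X in _ + (X + _)]big1 => [|k _]; last by rewrite scale0r.
  by rewrite add0r cy yE dE -big_split big1 // => k _; rewrite scaleNr /= subrr.
have [c zE] := spannedP (spanV z); move: dz; rewrite zE dE => c10.
(* The equation [d z = 0] is a linear relation among the [d (u k)], so by freeness no [u k] occurs
   in [z]; what remains is a combination of the cycles [b i] plus a coboundary. *)
pose e (j : I + (K + K)) :=
  match j with inl i => 0 | inr (inl k) => 0 | inr (inr k) => c (inr (inl k)) end.
have {}c10 k : c (inr (inl k)) = 0.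
  apply: (free_codomP (c := e) freef _ (inr (inr k))).
  by rewrite sumE /= c10 !big1 ?addr0 // => j _; rewrite scale0r.
exists (fun i => c (inl i)), (\sum_k c (inr (inr k)) *: u k); rewrite sumE.
rewrite [X in _ + (X + _)]big1 => [|k _]; last by rewrite c10 scale0r.
rewrite add0r; congr (_ + _).
by rewrite linear_sum; apply: eq_bigr => k _; rewrite linearZ.
Qed.

End CohomologyBasis.

(** * Products of anticommuting elements of square zero *)

Section AnticommutingProducts.
Variables (F : pzRingType) (A : algType F) (I : eqType) (f : I -> A).
Hypothesis fC : forall i j, f i * f j = - (f j * f i).
Hypothesis f2 : forall i, f i * f i = 0.

Lemma anticommute_prod x s : (forall i, x * f i = - (f i * x)) ->
  x * \prod_(i <- s) f i = (-1) ^+ size s *: (\prod_(i <- s) f i * x).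
Proof.
move=> xC; elim: s => [|i s IHs] /=; first by rewrite big_nil mulr1 mul1r scale1r.
by rewrite big_cons mulrA xC mulNr -(mulrA _ x) IHs -scalerAr exprS -scalerA scaleN1r mulrA.
Qed.

(** Each letter is moved to its place by successive transpositions. The sign stays existential,
    which suffices for membership in a span and for vanishing. *)
Lemma perm_anticommute_prod s t : perm_eq s t ->
  exists n : nat, \prod_(i <- s) f i = (-1) ^+ n *: \prod_(i <- t) f i.
Proof.
elim: s t => [|i s IHs] t.
  by rewrite perm_sym => /perm_nilP ->; exists 0; rewrite scale1r.
move=> pt; have ti : i \in t by rewrite -(perm_mem pt) mem_head.
case/splitPr: ti pt => t1 t2.
rewrite perm_sym -cat1s perm_catCA /= perm_cons perm_sym => pt.
have [n sE] := IHs _ pt.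
exists (n + size t1)%N; rewrite big_cons sE !big_cat big_cons /= -scalerAr (mulrA (f i)).
by rewrite (anticommute_prod t1 (fC i)) -scalerAl scalerA exprD mulrA.
Qed.

(** A repeated letter can be moved next to its other copy, where the square vanishes. *)
Lemma nuniq_anticommute_prod s : ~~ uniq s -> \prod_(i <- s) f i = 0.
Proof.
elim: s => //= i s IHs; rewrite negb_and negbK big_cons => /orP[si|/IHs->]; last first.
  by rewrite mulr0.
have [n ->] := perm_anticommute_prod (perm_to_rem si).
by rewrite big_cons -scalerAr mulrA f2 mul0r scaler0.
Qed.

End AnticommutingProducts.

(** * The exterior algebra and its differential *)

(* An alias, because the canonical ring structure on finite functions is the
   pointwise one. *)
Definition extalg (p : nat) : Type := {ffun {set gen} -> ('F_p)^o}.

HB.instance Definition _ (p : nat) := Vector.on (extalg p).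

Section ExteriorAlgebra.
Variable p : nat.
Local Notation E := (extalg p).
Implicit Types (x y z : E) (S T U : {set gen}) (s t : gen).

Lemma gidx_inj : injective gidx.
Proof.
move=> [a i] [b j]; rewrite /gidx /= => eq_ij.
have modE (c : 'I_3) (k : 'I_4) : ((4 * c + k) %% 4)%N = k.
  by rewrite mulnC modnMDl modn_small.
have eij : i = j by apply: val_inj; rewrite /= -(modE a i) eq_ij modE.
by move: eq_ij; rewrite eij => /addIn /eqP; rewrite eqn_pmul2l // => /eqP/val_inj->.
Qed.

Lemma escaleE (c : 'F_p) x : escale p c x = c *: x.
Proof. by apply/ffunP => U; rewrite !ffunE. Qed.

Definition ext_mono S : E := mono p S.
Definition ext_one : E := eone p.
Definition ext_mul x y : E := emul p x y.

Lemma extE x : x = \sum_S x S *: ext_mono S.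
Proof.
apply/ffunP=> U; rewrite sum_ffunE (bigD1 U) //= [X in _ + X]big1 => [|S neSU].
  by rewrite [LHS]/= addr0 !ffunE eqxx; apply: (esym (mulr1 _)).
by rewrite !ffunE eq_sym (negPf neSU); apply: scaler0.
Qed.

Lemma emulDl x y z : ext_mul (x + y) z = ext_mul x z + ext_mul y z.
Proof.
apply/ffunP=> U; rewrite [in RHS]ffunE !ffunE -big_split; apply: eq_bigr => S _.
rewrite -big_split; apply: eq_bigr => T _.
by rewrite !ffunE mulrDr mulrDl.
Qed.

Lemma emulDr x y z : ext_mul x (y + z) = ext_mul x y + ext_mul x z.
Proof.
apply/ffunP=> U; rewrite [in RHS]ffunE !ffunE -big_split; apply: eq_bigr => S _.
rewrite -big_split; apply: eq_bigr => T _.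
by rewrite !ffunE mulrDr.
Qed.

Lemma emulZl (c : 'F_p) x y : ext_mul (c *: x) y = c *: ext_mul x y.
Proof.
apply/ffunP=> U; rewrite !ffunE scaler_sumr; apply: eq_bigr => S _.
rewrite scaler_sumr; apply: eq_bigr => T _.
by rewrite !ffunE /GRing.scale /= !mulrA (mulrC c).
Qed.

Lemma emulZr (c : 'F_p) x y : ext_mul x (c *: y) = c *: ext_mul x y.
Proof.
apply/ffunP=> U; rewrite !ffunE scaler_sumr; apply: eq_bigr => S _.
rewrite scaler_sumr; apply: eq_bigr => T _.
by rewrite !ffunE /GRing.scale /= !mulrA (mulrC _ c) !mulrA.
Qed.

Lemma emul_mono S T :
  ext_mul (ext_mono S) (ext_mono T) =
  if [disjoint S & T] then sgnST p S T *: ext_mono (S :|: T) else 0.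
Proof.
apply/ffunP=> U; rewrite ffunE (bigD1 S) //= [X in _ + X]big1 ?addr0; last first.
  move=> S' /negPf neS; apply: big1 => T' _.
  by rewrite !ffunE neS mulr0 mul0r.
case: ifP => dST; last first.
  rewrite [RHS]ffunE big1 // => T' /andP[dST' _]; rewrite !ffunE eqxx.
  case: eqP => [eT|]; last by rewrite mulr0.
  by rewrite eT dST in dST'.
rewrite !ffunE; have [->|neU] := eqVneq U (S :|: T).
  rewrite (bigD1 T) ?dST ?eqxx //= !ffunE !eqxx big1 ?addr0 ?mulr1 => [|T'].
    exact: (esym (mulr1 _)).
  by move=> /andP[_ /negPf neT]; rewrite !ffunE neT mulr0.
rewrite big1 ?scaler0 // => T' /andP[_ /eqP eU]; rewrite !ffunE eqxx.
case: eqP => [eT|]; last by rewrite mulr0.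
by rewrite -eU eT eqxx in neU.
Qed.

Definition inversions S T := #|[set st in setX S T | (gidx st.2 < gidx st.1)%N]|.

(** As a double sum, the exponent of [sgnST] is visibly additive over disjoint unions in either
    argument. *)
Lemma inversionsE S T : inversions S T = (\sum_(s in S) \sum_(t in T) (gidx t < gidx s))%N.
Proof.
rewrite /inversions -sum1_card pair_big_dep /=.
rewrite big_mkcond [RHS]big_mkcond /=; apply: eq_bigr => -[s t] _ /=.
by rewrite !inE /=; case: (s \in S); case: (t \in T); case: ltnP.
Qed.

Lemma sum_disjointU S T (F : gen -> nat) : [disjoint S & T] ->
  (\sum_(s in S :|: T) F s = \sum_(s in S) F s + \sum_(s in T) F s)%N.
Proof. by move=> dST; rewrite -bigU //; apply: eq_bigl => s; rewrite !inE. Qed.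

Lemma inversions_setUl S T U : [disjoint S & T] ->
  inversions (S :|: T) U = (inversions S U + inversions T U)%N.
Proof. by move=> dST; rewrite !inversionsE sum_disjointU. Qed.

Lemma inversions_setUr S T U : [disjoint T & U] ->
  inversions S (T :|: U) = (inversions S T + inversions S U)%N.
Proof.
move=> dTU; rewrite !inversionsE -big_split; apply: eq_bigr => s _.
by rewrite sum_disjointU.
Qed.

Lemma sgnSTE S T : sgnST p S T = (-1) ^+ inversions S T.
Proof. by []. Qed.

Lemma emul0x x : ext_mul (0 : E) x = (0 : E).
Proof. by have := emulZl 0 0 x; rewrite !scale0r. Qed.

Lemma emulx0 x : ext_mul x (0 : E) = (0 : E).
Proof. by have := emulZr 0 x 0; rewrite !scale0r. Qed.

Lemma emul_sum_l (I : finType) (F : I -> E) y :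
  ext_mul (\sum_i F i) y = \sum_i ext_mul (F i) y.
Proof.
apply: (big_morph (fun x => ext_mul x y : E)) => [u v|]; first exact: emulDl.
exact: emul0x.
Qed.

Lemma emul_sum_r (I : finType) x (F : I -> E) :
  ext_mul x (\sum_i F i) = \sum_i ext_mul x (F i).
Proof.
apply: (big_morph (fun y => ext_mul x y : E)) => [u v|]; first exact: emulDr.
exact: emulx0.
Qed.

Lemma disjointUl S T U :
  [disjoint S :|: T & U] = [disjoint S & U] && [disjoint T & U].
Proof. by rewrite -!setI_eq0 setIUl setU_eq0. Qed.

Lemma disjointUr S T U :
  [disjoint S & T :|: U] = [disjoint S & T] && [disjoint S & U].
Proof. by rewrite -!setI_eq0 setIUr setU_eq0. Qed.

(** By additivity both exponents equal the sum of the inversions of the pairs [S, T], [S, U] and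
    [T, U]. This is the sign identity behind associativity. *)
Lemma sgnST_cocycle S T U : [disjoint S & T] -> [disjoint T & U] ->
  sgnST p T U * sgnST p S (T :|: U) = sgnST p S T * sgnST p (S :|: T) U.
Proof.
move=> dST dTU; rewrite !sgnSTE inversions_setUl // inversions_setUr //.
by rewrite !exprD mulrC -mulrA.
Qed.

Lemma emulA_mono S T U :
  ext_mul (ext_mono S) (ext_mul (ext_mono T) (ext_mono U)) =
  ext_mul (ext_mul (ext_mono S) (ext_mono T)) (ext_mono U).
Proof.
rewrite !emul_mono.
case dTU: [disjoint T & U]; case dST: [disjoint S & T].
- rewrite emulZl emulZr !emul_mono disjointUl disjointUr dST dTU andbT /=.
  case: [disjoint S & U]; last by rewrite !scaler0.
  by rewrite !scalerA setUA sgnST_cocycle.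
- by rewrite emulZr emul_mono disjointUr dST emul0x scaler0.
- by rewrite emulZl emul_mono disjointUl dTU andbF emulx0 scaler0.
- by rewrite emulx0 emul0x.
Qed.

Lemma emulA : associative ext_mul.
Proof.
exact: (bilinear_assoc extE emulDl emulDr emulZl emulZr emulA_mono).
Qed.

Lemma emul1x : left_id ext_one ext_mul.
Proof.
move=> x; rewrite [in RHS](extE x) {1}(extE x) emul_sum_r; apply: eq_bigr => S _.
rewrite emulZr emul_mono set0U sgnSTE inversionsE big_set0 scale1r.
by rewrite disjoints_subset sub0set.
Qed.

Lemma emulx1 : right_id ext_one ext_mul.
Proof.
move=> x; rewrite [in RHS](extE x) {1}(extE x) emul_sum_l; apply: eq_bigr => S _.
rewrite emulZl emul_mono setU0 sgnSTE inversionsE big1 ?scale1r => [|s _]; last first.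
  by rewrite big_set0.
by rewrite disjoint_sym disjoints_subset sub0set.
Qed.

Lemma eone_neq0 : ext_one != 0.
Proof.
apply/eqP => /ffunP /(_ set0); rewrite !ffunE eqxx => /eqP.
by rewrite oner_eq0.
Qed.

HB.instance Definition _ := GRing.Zmodule_isNzRing.Build E
  emulA emul1x emulx1 emulDl emulDr eone_neq0.

HB.instance Definition _ := GRing.Lmodule_isLalgebra.Build 'F_p E
  (fun a x y => esym (emulZl a x y)).
HB.instance Definition _ := GRing.Lalgebra_isAlgebra.Build 'F_p E
  (fun a x y => esym (emulZr a x y)).

Lemma emulE x y : emul p x y = x * y. Proof. by []. Qed.
Lemma monoM S T : ext_mono S * ext_mono T =
  if [disjoint S & T] then sgnST p S T *: ext_mono (S :|: T) else 0.
Proof. exact: emul_mono. Qed.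

End ExteriorAlgebra.

(** * The differential as a derivation of square zero *)

Section Differential.
Variable p : nat.
Local Notation E := (extalg p).
Implicit Types (x y z : E) (S T U : {set gen}) (s t : gen).

Definition gmono s : E := ext_mono p [set s].

(** This is the exponent in [dmono]; it also counts the letters of [S] that [s] passes when
    multiplied in from the left. *)
Definition rank S s := #|[set t in S | (gidx t < gidx s)%N]|.

Lemma rankE S s : rank S s = (\sum_(t in S) (gidx t < gidx s))%N.
Proof.
rewrite /rank -sum1_card big_mkcond [RHS]big_mkcond /=; apply: eq_bigr => t _.
by rewrite !inE; case: (t \in S); case: ltnP.
Qed.

Lemma rankU1 S s t : t \notin S -> rank (t |: S) s = ((gidx t < gidx s) + rank S s)%N.
Proof. by move=> tS; rewrite !rankE big_setU1. Qed.

Lemma rankD1 S s t : t \in S -> rank S s = ((gidx t < gidx s) + rank (S :\ t) s)%N.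
Proof. by move=> tS; rewrite !rankE (big_setD1 t). Qed.

Lemma gmonoM s S :
  gmono s * ext_mono p S =
  if s \in S then 0 else ((-1) ^+ rank S s : 'F_p) *: (ext_mono p (s |: S)).
Proof.
rewrite /gmono monoM disjoints1 sgnSTE inversionsE big_set1 -rankE.
by case: (s \in S).
Qed.

Lemma gmonoC s t : gmono s * gmono t = - (gmono t * gmono s).
Proof.
rewrite {2 3}/gmono !gmonoM !inE (eq_sym t s).
have [_|neq_st] := eqVneq s t; first by rewrite oppr0.
rewrite setUC !rankE !big_set1; have := inj_eq gidx_inj s t; rewrite (negPf neq_st).
by case: ltngtP => // _ _; rewrite expr0 expr1 scaleN1r scale1r ?opprK.
Qed.

Lemma gmono_sq s : gmono s * gmono s = 0.
Proof. by rewrite {2}/gmono gmonoM inE eqxx. Qed.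

Definition dext x : E := dM p x.

Lemma dextE x : dext x = \sum_S x S *: (dmono p S : E).
Proof. by apply: eq_bigr => S _; rewrite escaleE. Qed.

Lemma dext_is_linear : linear dext.
Proof.
move=> a x y; rewrite !dextE scaler_sumr -big_split; apply: eq_bigr => S _.
by rewrite !ffunE scalerDl scalerA.
Qed.

HB.instance Definition _ := GRing.isLinear.Build 'F_p E E _ dext dext_is_linear.

Definition ext_dgen s : E := dgen p s.

Lemma dext_mono S : dext (ext_mono p S) =
  \sum_(s in S) ((-1) ^+ rank S s : 'F_p) *: (ext_dgen s * (ext_mono p (S :\ s))).
Proof.
rewrite dextE (bigD1 S) //= ffunE eqxx scale1r [X in _ + X]big1 ?addr0.
  by apply: eq_bigr => s _; rewrite escaleE.
by move=> T /negPf neT; rewrite ffunE neT scale0r.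
Qed.

Lemma ext_dgenE s :
  ext_dgen s = if s.1 == 2 then - (gmono (0, s.2) * gmono (0, s.2 + 2)) else 0.
Proof. by []. Qed.

(** The differential of a generator is zero or a product of two generators, and passing two letters
    costs two signs. *)
Lemma dgen_comm s t : ext_dgen s * gmono t = gmono t * ext_dgen s.
Proof.
rewrite ext_dgenE; case: ifP => _; last by rewrite mulr0 mul0r.
rewrite mulrN mulNr; congr (- _).
by rewrite -mulrA (gmonoC _ t) mulrN mulrA (gmonoC _ t) mulNr opprK mulrA.
Qed.

Lemma signrMK (n : nat) : (-1) ^+ n * (-1) ^+ n = 1 :> 'F_p.
Proof. by rewrite -exprMn mulrNN mulr1 expr1n. Qed.

Lemma dext_gmonoM_mono s T :
  dext (gmono s * ext_mono p T) =
  ext_dgen s * (ext_mono p T) - gmono s * dext (ext_mono p T).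
Proof.
rewrite gmonoM; case: ifP => [sT | /negbT sT].
  (* If [s] lies in [T], the left side is zero. On the right, [gmono s] kills every summand of the
     differential except the one that removes [s], and that one cancels the first term. *)
  rewrite linear0 dext_mono mulr_sumr (bigD1 s) //= big1 => [|t /andP[_ neq_ts]].
    rewrite addr0 -scalerAr mulrA -dgen_comm -mulrA gmonoM !inE eqxx /=.
    rewrite (rankD1 s sT) ltnn setD1K // -scalerAr scalerA signrMK scale1r.
    by rewrite subrr.
  rewrite -scalerAr mulrA -dgen_comm -mulrA gmonoM !inE eq_sym neq_ts sT /=.
  by rewrite mulr0 scaler0.
(* If [s] is not in [T], the summand removing [s] is the first term on the right; the summands
   removing some [t] in [T] are matched one by one with those of the second. *)
rewrite linearZ /= dext_mono big_setU1 //= setU1K // rankU1 // ltnn scalerDr.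
rewrite scalerA signrMK scale1r; congr (_ + _).
rewrite dext_mono mulr_sumr scaler_sumr -sumrN; apply: eq_bigr => t tT.
have neq_st : s != t by apply: contraNneq sT => ->.
have -> : (s |: T) :\ t = s |: T :\ t.
  by apply/setP=> u; rewrite !inE; case: (u =P s) => // ->; rewrite neq_st.
rewrite -scalerAr mulrA -dgen_comm -mulrA gmonoM !inE (negPf sT) andbF -scalerAr.
rewrite !scalerA -scaleNr; congr (_ *: _).
(* Exactly one of the comparisons of [gidx s] with [gidx t] contributes one to the exponent, on the
   left side only; this is the minus sign of the Leibniz rule. *)
rewrite rankU1 // (rankD1 s tT) -!exprD.
have := inj_eq gidx_inj s t; rewrite (negPf neq_st).
case: ltngtP => // _ _; rewrite ?add0n ?add1n ?addn1 ?addSn ?addnS exprS mulN1r;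
  by rewrite addnC.
Qed.

Lemma dext_gmonoM s x : dext (gmono s * x) = ext_dgen s * x - gmono s * dext x.
Proof. exact: (leibniz_of_basis (d := dext) (@extE p) (dext_gmonoM_mono s)). Qed.

Lemma dext_h2M j x : dext (gmono (0, j) * x) = - (gmono (0, j) * dext x).
Proof. by rewrite dext_gmonoM ext_dgenE mul0r sub0r. Qed.

Lemma dext_dgenM s x : dext (ext_dgen s * x) = ext_dgen s * dext x.
Proof.
rewrite ext_dgenE; case: ifP => _; last by rewrite !mul0r linear0.
by rewrite !mulNr linearN /= -!mulrA !dext_h2M mulrN opprK.
Qed.

Lemma dext1 : dext 1 = 0.
Proof. by rewrite [1]/(ext_mono p set0) dext_mono big_set0. Qed.

Lemma mono_gmono s S : s \in S -> exists c : 'F_p,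
  ext_mono p S = c *: (gmono s * ext_mono p (S :\ s)) :> E.
Proof.
move=> sS; exists ((-1) ^+ rank (S :\ s) s).
by rewrite gmonoM !inE eqxx /= setD1K // scalerA signrMK scale1r.
Qed.

(** Generators are peeled off a monomial one at a time until [1] is left. The principle serves both
    for [dextK] and for the proof that the chosen family spans. *)
Lemma mono_ind (P : E -> Prop) :
    P 1 -> (forall x y, P x -> P y -> P (x + y)) ->
    (forall (c : 'F_p) x, P x -> P (c *: x)) ->
    (forall s x, P x -> P (gmono s * x)) ->
  forall x, P x.
Proof.
move=> P1 PD PZ PM.
have Pmono S : P (ext_mono p S).
  have [n] := ubnP #|S|; elim: n S => // n IHn S; rewrite ltnS => leSn.
  have [->|[s sS]] := set_0Vmem S; first exact: P1.
  have [c ->] := mono_gmono sS; apply/PZ/PM/IHn.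
  by apply: leq_trans leSn; rewrite [X in (_ < X)%N](cardsD1 s) sS.
move=> x; rewrite (extE x); apply: big_ind => // [|S _]; last exact: PZ.
by rewrite -(scale0r 1); apply: PZ.
Qed.

Lemma dextK x : dext (dext x) = 0.
Proof.
elim/mono_ind: x => [|x y dx dy|c x dx|s x dx].
- by rewrite dext1 linear0.
- by rewrite !linearD /= dx dy addr0.
- by rewrite !linearZ /= dx scaler0.
by rewrite dext_gmonoM linearB /= dext_dgenM dext_gmonoM dx mulr0 subr0 subrr.
Qed.

End Differential.

(** * Computing with words *)

Local Open Scope nat_scope.

(* A term [(e, w)] stands for (-1)^e times the product of the generators named
   by the word [w]; letters 0-3, 4-7 and 8-11 name h_{2,j}, h_{3,j} and h_{4,j},
   and a list of terms is their sum. *)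
Definition term : Type := bool * seq nat.

Definition tneg (t : term) : term := (~~ t.1, t.2).
Definition tmul (t u : term) : term := (t.1 (+) u.1, t.2 ++ u.2).
Definition pmul (P Q : seq term) : seq term := [seq tmul t u | t <- P, u <- Q].

(** The reduction mod 3 agrees with the wrap-around of [inZp] in [hletter], so that evaluation is
    correct for every natural number [i]. *)
Definition dletter (i : nat) : seq term :=
  if (i %/ 4) %% 3 == 2 then [:: (true, [:: i %% 4; (i + 2) %% 4])] else [::].

Fixpoint dword (w : seq nat) : seq term :=
  if w is i :: w' then
    [seq tmul t (false, w') | t <- dletter i]
    ++ [seq tmul (true, [:: i]) t | t <- dword w']
  else [::].

Definition pdiff (P : seq term) : seq term :=
  [seq tmul (t.1, [::]) u | t <- P, u <- dword t.2].

(** Insertion into an increasing word with one sign per letter passed; [None] stands for the zero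
    that a repeated letter produces. *)
Fixpoint winsert (i : nat) (w : seq nat) : option term :=
  if w is j :: w' then
    if i < j then Some (false, i :: w)
    else if i == j then None
    else omap (tmul (true, [:: j])) (winsert i w')
  else Some (false, [:: i]).

Fixpoint wnorm (w : seq nat) : option term :=
  if w is i :: w' then
    if wnorm w' is Some t then omap (tmul (t.1, [::])) (winsert i t.2) else None
  else Some (false, [::]).

(** Integer coefficients are represented by repetition, and a term cancels only against its
    opposite, so the computation is independent of the characteristic. *)
Definition padd (t : term) (P : seq term) : seq term :=
  if tneg t \in P then rem (tneg t) P else t :: P.

Definition pnorm (P : seq term) : seq term :=
  foldr (fun t Q => if wnorm t.2 is Some u then padd (tmul (t.1, [::]) u) Q else Q)
        [::] P.

Definition peq (P Q : seq term) : bool := nilp (pnorm (P ++ map tneg Q)).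

Definition ph2 (j : nat) : seq term := [:: (false, [:: j %% 4])].
Definition ph3 (j : nat) : seq term := [:: (false, [:: 4 + j %% 4])].
Definition ph4 (j : nat) : seq term := [:: (false, [:: 8 + j %% 4])].
Definition pe (j : nat) : seq term := pmul (ph2 j) (ph2 (j + 1)).
Definition pg (j : nat) : seq term := pmul (ph4 j) (ph2 j).
Definition pegen (i : nat) : seq term :=
  if i < 4 then ph3 i else if i == 4 then ph4 0 ++ ph4 2 else ph4 1 ++ ph4 3.

Definition paleph : seq (seq term) :=
  [:: [:: (false, [::])]] ++
  [seq ph2 j | j <- iota 0 4] ++
  [seq pe j | j <- iota 0 4] ++
  [seq pg j | j <- iota 0 4] ++
  [seq pmul (ph2 j) (pg (j + 1)) | j <- iota 0 4] ++
  [seq pmul (ph2 j) (pg (j + 2)) | j <- iota 0 2] ++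
  [seq pmul (ph2 j) (pg (j + 3)) | j <- iota 0 4] ++
  [seq pmul (pg j) (pg (j + 1)) | j <- iota 0 4] ++
  [seq pmul (pe j) (pg (j + 2)) | j <- iota 0 4] ++
  [seq pmul (pmul (ph2 j) (pg (j + 1))) (pg (j + 2)) | j <- iota 0 4] ++
  [:: pmul (pmul (pe 0) (pg 2)) (pg 3)].

(* The six classes of E[h_{2,i}, h_{2,i+2}, h_{4,i}], up to multiples of rho_i. *)
Definition pcoh (i : nat) : seq (seq term) :=
  [:: [:: (false, [::])]; ph2 i; ph2 (i + 2); pg i; pg (i + 2);
      pmul (ph2 i) (pg (i + 2))].

(** Write each three-generator complex as cohomology plus the acyclic pair on h_{4,i}. The tensor
    product has three acyclic summands: pair 0 times cohomology 1, cohomology 0 times pair 1, and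
    pair times pair. They contribute 6, 6 and 2 elements [u]. *)
Definition pacyc : seq (seq term) :=
  [seq pmul (ph4 0) P | P <- pcoh 1] ++ [seq pmul (ph4 1) P | P <- pcoh 0] ++
  [:: pmul (ph4 0) (ph4 1); pmul (ph4 0) (pdiff (ph4 1))].

Definition pbasis : seq (seq term) := paleph ++ pacyc ++ map pdiff pacyc.

(** The letters h_{2,j}, h_{4,0}, h_{4,1}, which together with the h_{3,j}, rho_0 and rho_1 generate
    the algebra. *)
Definition yletter (i : nat) : nat := if i < 4 then i else i + 4.

(* Row [n] expands, in terms of [pbasis], the product of the letters
   0, 1, 2, 3, 8, 9 selected by the binary digits of [n], most significant
   first; an entry [(e, r, k)] stands for (-1)^e rho_0^r0 rho_1^r1 times element
   [k], where r = r0 + 2 r1. *)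
Definition expansions : seq (seq (nat * nat * nat)) :=
  [:: [:: (0, 0, 0)]; [:: (0, 0, 42)]; [:: (0, 0, 36)]; [:: (0, 0, 48)];
      [:: (0, 0, 4)]; [:: (0, 0, 12); (1, 2, 4)]; [:: (1, 0, 38)];
      [:: (1, 0, 40); (1, 2, 38)]; [:: (0, 0, 3)]; [:: (1, 0, 44)];
      [:: (0, 0, 11); (1, 1, 3)]; [:: (0, 0, 46); (0, 1, 44)]; [:: (0, 0, 7)];
      [:: (0, 0, 15); (0, 2, 7)]; [:: (1, 0, 22); (0, 1, 7)];
      [:: (1, 0, 25); (0, 1, 15); (0, 2, 22); (0, 3, 7)]; [:: (0, 0, 2)];
      [:: (1, 0, 10)]; [:: (1, 0, 37)]; [:: (0, 0, 39)]; [:: (1, 0, 56)];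
      [:: (0, 0, 18); (1, 2, 56)]; [:: (1, 0, 49)]; [:: (0, 0, 41); (0, 2, 49)];
      [:: (0, 0, 6)]; [:: (0, 0, 21)]; [:: (0, 0, 14); (0, 1, 6)];
      [:: (1, 0, 24); (0, 1, 21)]; [:: (0, 0, 58)]; [:: (0, 0, 28); (1, 2, 58)];
      [:: (0, 0, 60); (1, 1, 58)];
      [:: (1, 0, 32); (1, 1, 28); (0, 2, 60); (0, 3, 58)]; [:: (0, 0, 1)];
      [:: (1, 0, 43)]; [:: (1, 0, 9)]; [:: (1, 0, 45)]; [:: (1, 0, 8)];
      [:: (0, 0, 19); (1, 2, 8)]; [:: (0, 0, 16)]; [:: (0, 0, 26); (1, 2, 16)];
      [:: (1, 0, 50)]; [:: (1, 0, 49); (1, 0, 62)]; [:: (0, 0, 17); (1, 1, 50)];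
      [:: (1, 0, 47); (1, 1, 49); (1, 1, 62)]; [:: (1, 0, 52)];
      [:: (1, 0, 54); (0, 2, 52)]; [:: (1, 0, 29)]; [:: (1, 0, 33); (1, 2, 29)];
      [:: (0, 0, 5)]; [:: (1, 0, 13)]; [:: (0, 0, 20)]; [:: (1, 0, 23)];
      [:: (1, 0, 57)]; [:: (1, 0, 30)]; [:: (0, 0, 59)]; [:: (1, 0, 34)];
      [:: (0, 0, 51)]; [:: (1, 0, 53)]; [:: (0, 0, 27); (1, 1, 51)];
      [:: (1, 0, 31); (0, 1, 53)]; [:: (1, 0, 63)]; [:: (0, 0, 55); (1, 2, 63)];
      [:: (0, 0, 61); (1, 1, 63)];
      [:: (1, 0, 35); (0, 1, 55); (1, 2, 61); (1, 3, 63)]].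

Definition rho_word (r : nat) : seq 'I_6 := mask [:: odd r; 1 < r] [:: inZp 4; inZp 5].

Definition peprod (s : seq 'I_6) : seq term :=
  foldr pmul [:: (false, [::])] [seq pegen (val i) | i <- s].

Definition prow (r : seq (nat * nat * nat)) : seq term :=
  flatten [seq let: (e, r, k) := t in
               pmul [:: (odd e, [::])] (pmul (peprod (rho_word r)) (nth [::] pbasis k))
          | t <- r].

Definition row_of (m : bitseq) : seq (nat * nat * nat) :=
  nth [::] expansions (foldl (fun n (b : bool) => (n.*2 + b)%N) 0%N m).

Fixpoint all_masks (n : nat) (q : pred bitseq) : bool :=
  if n is n'.+1 then
    all_masks n' (fun m => q (false :: m)) && all_masks n' (fun m => q (true :: m))
  else q [::].

Lemma all_masksP n (q : pred bitseq) : all_masks n q -> forall m, size m = n -> q m.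
Proof.
elim: n q => [|n IHn] q /=; first by move=> q0 [].
move=> /andP[q0 q1] [//|[] m] [sz_m].
  exact: (IHn _ q1).
exact: (IHn _ q0).
Qed.

(** The table is verified row by row, by normalizing the difference of the two sides for each of the
    64 masks. *)
Lemma expansions_correct m : size m = 6 ->
  peq [:: (false, mask m [seq yletter i | i <- iota 0 6])] (prow (row_of m)).
Proof.
apply: (@all_masksP _ (fun m => peq [:: (false, mask m _)] (prow (row_of m)))).
by vm_compute.
Qed.

Local Close Scope nat_scope.

(** * Soundness of the word calculus, and the spanning argument *)

Section Evaluation.
Variables (F : fieldType) (A : algType F) (h : nat -> A).
Hypothesis hC : forall i j, h i * h j = - (h j * h i).
Hypothesis h_sq : forall i, h i * h i = 0.

Definition weval (w : seq nat) : A := \prod_(i <- w) h i.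
Definition teval (t : term) : A := (-1) ^+ t.1 *: weval t.2.
Definition peval (P : seq term) : A := \sum_(t <- P) teval t.

Lemma tevalM t u : teval (tmul t u) = teval t * teval u.
Proof.
rewrite /teval /weval /= signr_addb big_cat /=.
by rewrite -scalerAl -scalerAr scalerA.
Qed.

Lemma tevalN t : teval (tneg t) = - teval t.
Proof. by rewrite /teval /= signrN scaleNr. Qed.

Lemma teval_sign (e : bool) t : teval (tmul (e, [::]) t) = (-1) ^+ e *: teval t.
Proof. by rewrite tevalM /teval /weval big_nil -scalerAl mul1r. Qed.

Lemma teval_word w : teval (false, w) = weval w.
Proof. by rewrite /teval scale1r. Qed.

Lemma peval1 t : peval [:: t] = teval t.
Proof. by rewrite /peval big_seq1. Qed.

Lemma peval_nil : peval [::] = 0.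
Proof. by rewrite /peval big_nil. Qed.

Lemma pevalD P Q : peval (P ++ Q) = peval P + peval Q.
Proof. by rewrite /peval big_cat. Qed.

Lemma pevalN P : peval (map tneg P) = - peval P.
Proof. by rewrite /peval big_map -sumrN; apply: eq_bigr => t _; rewrite tevalN. Qed.

Lemma pevalM P Q : peval (pmul P Q) = peval P * peval Q.
Proof.
rewrite /peval big_allpairs_dep mulr_suml; apply: eq_bigr => t _.
by rewrite mulr_sumr; apply: eq_bigr => u _; rewrite tevalM.
Qed.

Definition oeval (o : option term) : A := oapp teval 0 o.

Lemma oeval_tmul t o : oeval (omap (tmul t) o) = teval t * oeval o.
Proof. by case: o => [u|] /=; rewrite ?tevalM ?mulr0. Qed.

Lemma winsertE i w : oeval (winsert i w) = h i * weval w.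
Proof.
elim: w => [|j w IHw] /=; first by rewrite teval_word /weval big_seq1 big_nil mulr1.
case: ifP => _; first by rewrite /= teval_word /weval !big_cons.
case: eqP => [->|_]; first by rewrite /= /weval big_cons mulrA h_sq mul0r.
rewrite oeval_tmul IHw /teval /weval big_seq1 big_cons /= [RHS]mulrA hC.
by rewrite scaleN1r !mulNr mulrA.
Qed.

Lemma wnormE w : oeval (wnorm w) = weval w.
Proof.
elim: w => [|i w IHw] /=; first exact: teval_word.
rewrite /weval big_cons -/(weval w) -IHw; case: (wnorm w) => [t|] /=; last first.
  by rewrite mulr0.
rewrite oeval_tmul winsertE /teval [weval [::]]big_nil /= -scalerAl mul1r.
by rewrite -scalerAr.
Qed.

Lemma paddE t P : peval (padd t P) = teval t + peval P.
Proof.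
rewrite /padd; case: ifP => [tP|_]; last by rewrite /peval big_cons.
by rewrite /peval [in RHS](big_rem _ tP) /= tevalN addrA subrr add0r.
Qed.

Lemma pnormE P : peval (pnorm P) = peval P.
Proof.
elim: P => //= t P IHP; rewrite [RHS]big_cons -/(peval P) -IHP.
rewrite {1}/teval -wnormE; case: (wnorm t.2) => [u|] /=; last first.
  by rewrite scaler0 add0r.
by rewrite paddE teval_sign.
Qed.

Lemma peqP P Q : peq P Q -> peval P = peval Q.
Proof.
move=> /nilP PQ; apply/eqP; rewrite -subr_eq0 -pevalN -pevalD -pnormE PQ.
by rewrite peval_nil.
Qed.

Definition eg (i : 'I_6) : A := peval (pegen i).
Definition yg (i : 'I_6) : A := h (yletter i).

Lemma all_ord6 (q : nat -> nat -> bool) :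
  all (fun i => all (q i) (iota 0 6)) (iota 0 6) -> forall i j : 'I_6, q i j.
Proof.
have ord6 (i : 'I_6) : val i \in iota 0 6 by rewrite mem_iota /=.
by move=> /allP q6 i j; have /allP := q6 _ (ord6 i); apply; apply: ord6.
Qed.

Lemma egC i j : eg i * eg j = - (eg j * eg i).
Proof.
rewrite /eg -!pevalM -pevalN; apply: peqP.
pose q i j := peq (pmul (pegen i) (pegen j)) (map tneg (pmul (pegen j) (pegen i))).
by apply: (@all_ord6 q); vm_compute.
Qed.

Lemma eg_sq i : eg i * eg i = 0.
Proof.
transitivity (peval [::]); last exact: peval_nil.
rewrite /eg -!pevalM; apply: peqP.
pose q i (j : nat) := peq (pmul (pegen i) (pegen i)) [::].
by apply: (@all_ord6 q _ i i); vm_compute.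
Qed.

Lemma ygE i : yg i = peval [:: (false, [:: yletter i])].
Proof. by rewrite peval1 teval_word /weval big_seq1. Qed.

Lemma ygeg i j : yg i * eg j = - (eg j * yg i).
Proof.
rewrite ygE /eg -!pevalM -pevalN; apply: peqP.
pose y i : seq term := [:: (false, [:: yletter i])].
pose q i j := peq (pmul (y i) (pegen j)) (map tneg (pmul (pegen j) (y i))).
by apply: (@all_ord6 q); vm_compute.
Qed.

Lemma peprodE s : peval (peprod s) = \prod_(i <- s) eg i.
Proof.
elim: s => [|i s IHs] /=.
  by rewrite peval1 teval_word /weval !big_nil.
by rewrite pevalM IHs big_cons.
Qed.

(** Since [pbasis] has 36 + 14 + 14 entries, there are 64 * 64 = 2^12 indices, as many as the
    dimension of the exterior algebra. *)
Definition total_family (x : {set 'I_6} * 'I_(size pbasis)) : A :=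
  (\prod_(i <- enum x.1) eg i) * peval (nth [::] pbasis x.2).

(** Arbitrary words are allowed because an expansion appends factors rho_0 and rho_1 to a given
    word, possibly repeating a letter. *)
Lemma spanned_eprod s k :
  spanned total_family ((\prod_(i <- s) eg i) * peval (nth [::] pbasis k)).
Proof.
have [us|nus] := boolP (uniq s); last first.
  by rewrite (nuniq_anticommute_prod egC eg_sq) // mul0r; apply: Spanned0.
have [ltk|lek] := ltnP k (size pbasis); last first.
  by rewrite nth_default // peval_nil mulr0; apply: Spanned0.
have ps : perm_eq s (enum [set i in s]).
  by apply: uniq_perm; rewrite ?enum_uniq // => i; rewrite mem_enum inE.
have [n ->] := perm_anticommute_prod egC ps.
by rewrite -scalerAl; apply/SpannedZ/(SpannedB _ (_, Ordinal ltk)).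
Qed.

Lemma spanned_prow s r : spanned total_family ((\prod_(i <- s) eg i) * peval (prow r)).
Proof.
rewrite /prow; elim: r => [|[[e r] k] l IHl] /=.
  by rewrite peval_nil mulr0; apply: Spanned0.
rewrite pevalD mulrDr; apply: SpannedD => //.
rewrite !pevalM peval1 /teval [weval _]big_nil -scalerAl mul1r -scalerAr.
by apply: SpannedZ; rewrite mulrA peprodE -big_cat; apply: spanned_eprod.
Qed.

Lemma spanned_monomial s (T : {set 'I_6}) :
  spanned total_family ((\prod_(i <- s) eg i) * \prod_(i <- enum T) yg i).
Proof.
(* The elements of [T] in increasing order are selected from 0..5 by a mask, whose binary value is
   the row number in the table. *)
have /subseqP[m sz_m mE] : subseq (map val (enum T)) (iota 0 6).
  by rewrite -val_enum_ord map_subseq // enumT [enum T]/enum_mem filter_subseq.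
rewrite size_iota in sz_m.
have -> : \prod_(i <- enum T) yg i = peval (prow (row_of m)).
  rewrite -(peqP (expansions_correct sz_m)) peval1 teval_word -map_mask -mE.
  by rewrite /weval !big_map.
exact: spanned_prow.
Qed.

Lemma ygC i j : yg i * yg j = - (yg j * yg i). Proof. exact: hC. Qed.
Lemma yg_sq i : yg i * yg i = 0. Proof. exact: h_sq. Qed.

(** With words as indices, left multiplication by a letter of either kind permutes the family up to
    extension of a word and a sign. *)
Definition ey_family (st : seq 'I_6 * seq 'I_6) : A :=
  (\prod_(i <- st.1) eg i) * \prod_(i <- st.2) yg i.

Lemma spanned_ey x : spanned ey_family x -> spanned total_family x.
Proof.
apply: spanned_trans => -[s t] /=; rewrite /ey_family /=.
have [ut|nut] := boolP (uniq t); last first.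
  by rewrite (nuniq_anticommute_prod ygC yg_sq) // mulr0; apply: Spanned0.
have pt : perm_eq t (enum [set i in t]).
  by apply: uniq_perm; rewrite ?enum_uniq // => i; rewrite mem_enum inE.
have [n ->] := perm_anticommute_prod ygC pt.
by rewrite -scalerAr; apply/SpannedZ/spanned_monomial.
Qed.

Lemma eg_spanned i x : spanned ey_family x -> spanned ey_family (eg i * x).
Proof.
apply: spanned_mull => -[s t] /=; rewrite /ey_family /=.
by have := SpannedB ey_family (i :: s, t); rewrite /ey_family /= big_cons mulrA.
Qed.

Lemma yg_spanned i x : spanned ey_family x -> spanned ey_family (yg i * x).
Proof.
apply: spanned_mull => -[s t] /=; rewrite /ey_family /=.
rewrite mulrA (anticommute_prod s (ygeg i)) -scalerAl; apply: SpannedZ.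
by have := SpannedB ey_family (s, i :: t); rewrite /ey_family /= big_cons mulrA.
Qed.

Lemma h_spanned i x : (i < 12)%N -> spanned ey_family x -> spanned ey_family (h i * x).
Proof.
move=> lti sx.
have Y k : (k < 6)%N -> spanned ey_family (h (yletter k) * x).
  by move=> ltk; apply: (yg_spanned (Ordinal ltk) sx).
have E k : (k < 6)%N -> spanned ey_family (peval (pegen k) * x).
  by move=> ltk; apply: (eg_spanned (Ordinal ltk) sx).
have E3 k : (k < 4)%N -> spanned ey_family (h (4 + k) * x).
  move=> ltk; have := E k (@ltn_trans 4 k 6 ltk isT).
  by rewrite /pegen ltk peval1 teval_word /weval big_seq1 modn_small.
have ph4E k : peval (ph4 k) = h (8 + k %% 4).
  by rewrite peval1 teval_word /weval big_seq1.
(* The two letters outside both kinds are differences: h_{4,2} = rho_0 - h_{4,0}, and likewise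
   h_{4,3} = rho_1 - h_{4,1}. *)
have E4 : spanned ey_family (h 10 * x).
  have := SpannedD (E 4 isT) (SpannedZ (-1) (Y 4 isT)).
  by rewrite pevalD !ph4E mulrDl scaleN1r addrAC subrr add0r.
have E5 : spanned ey_family (h 11 * x).
  have := SpannedD (E 5 isT) (SpannedZ (-1) (Y 5 isT)).
  by rewrite pevalD !ph4E mulrDl scaleN1r addrAC subrr add0r.
move: lti; case: i => [|[|[|[|[|[|[|[|[|[|[|[|i]]]]]]]]]]]] // _.
- exact: (Y 0%N).
- exact: (Y 1%N).
- exact: (Y 2%N).
- exact: (Y 3%N).
- exact: (E3 0%N).
- exact: (E3 1%N).
- exact: (E3 2%N).
- exact: (E3 3%N).
- exact: (Y 4%N).
- exact: (Y 5%N).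
Qed.

(** The hypothesis expresses that the twelve letters generate [A]; the span contains [1] and is
    stable under each of them. *)
Lemma total_family_spans :
    (forall P : A -> Prop, P 1 -> (forall x y, P x -> P y -> P (x + y)) ->
       (forall c x, P x -> P (c *: x)) ->
       (forall i x, (i < 12)%N -> P x -> P (h i * x)) -> forall x, P x) ->
  forall x, spanned total_family x.
Proof.
move=> h_ind x; apply: spanned_ey; elim/h_ind: x => [|x y|c x|i x].
- have := SpannedB ey_family ([::], [::]).
  by rewrite /ey_family !big_nil mulr1.
- exact: SpannedD.
- exact: SpannedZ.
- exact: h_spanned.
Qed.

(** * The differential computed on words *)

Section Derivation.
Variable d : {linear A -> A}.
Hypothesis d1 : d 1 = 0.
Hypothesis dh : forall i x, d (h i * x) = peval (dletter i) * x - h i * d x.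

Lemma dwordE w : peval (dword w) = d (weval w).
Proof.
elim: w => [|i w IHw]; first by rewrite /weval /peval !big_nil d1.
rewrite [weval _]big_cons -/(weval w) dh -IHw /= pevalD; congr (_ + _).
  rewrite /peval big_map mulr_suml; apply: eq_bigr => t _.
  by rewrite tevalM teval_word.
rewrite /peval big_map mulr_sumr -sumrN; apply: eq_bigr => t _.
by rewrite tevalM /teval /= {1}/weval big_seq1 scaleN1r mulNr.
Qed.

Lemma pdiffE P : peval (pdiff P) = d (peval P).
Proof.
rewrite /peval big_allpairs_dep linear_sum; apply: eq_bigr => t _.
rewrite /teval linearZ /= -dwordE /peval scaler_sumr; apply: eq_bigr => u _.
exact: teval_sign.
Qed.

Lemma linear_form_leibniz P x : all (fun t => size t.2 == 1) P ->
  d (peval P * x) = peval (pdiff P) * x - peval P * d x.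
Proof.
move=> /allP P1; rewrite pdiffE /peval !mulr_suml !linear_sum mulr_suml -big_split.
rewrite [LHS]big_seq [RHS]big_seq; apply: eq_bigr => -[e w] /P1 /=.
case: w => [|i [|]] // _.
have dhi : d (h i) = peval (dletter i) by have := dh i 1; rewrite !mulr1 d1 mulr0 subr0.
by rewrite /teval /weval big_seq1 -!scalerAl !linearZ /= dh dhi -scalerAl scalerBr scalerN.
Qed.

(** The factors [eg i] are cycles of degree one: for rho_0 and rho_1 the differentials of the two
    summands cancel by anticommutation. *)
Lemma d_egM i x : d (eg i * x) = - (eg i * d x).
Proof.
rewrite linear_form_leibniz; last by rewrite /pegen; do 2?case: ifP.
suff -> : peval (pdiff (pegen i)) = peval [::] by rewrite peval_nil mul0r sub0r.
apply: peqP; pose q i (j : nat) := peq (pdiff (pegen i)) [::].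
by apply: (@all_ord6 q _ i i); vm_compute.
Qed.

Lemma d_eprodM s x :
  d ((\prod_(i <- s) eg i) * x) = (-1) ^+ size s *: ((\prod_(i <- s) eg i) * d x).
Proof.
elim: s x => [|i s IHs] x; first by rewrite big_nil !mul1r scale1r.
by rewrite big_cons -!mulrA d_egM IHs -scalerAr exprS -scalerA scaleN1r.
Qed.

Lemma d_paleph k : d (peval (nth [::] paleph k)) = 0.
Proof.
rewrite -pdiffE; transitivity (peval [::]); last exact: peval_nil.
have [ltk|lek] := ltnP k (size paleph); last by rewrite nth_default.
apply: peqP; have /all_nthP := (isT : all (fun P => peq (pdiff P) [::]) paleph).
by move/(_ [::] k ltk).
Qed.

Definition acyclic_family (x : {set 'I_6} * 'I_14) : A :=
  (\prod_(i <- enum x.1) eg i) * peval (nth [::] pacyc x.2).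

(** The families differ in their last block only, where an [eg]-monomial times [d u] is, up to sign,
    the differential of that monomial times [u]. The separate [n] accommodates the index type of
    [ecfamily], whose bound is [size (aleph p)]. *)
Lemma split_family_spans n (b : {set 'I_6} * 'I_n -> A) :
    n = size paleph ->
    (forall x, b x = (\prod_(i <- enum x.1) eg i) * peval (nth [::] paleph x.2)) ->
    (forall x, spanned total_family x) ->
  forall x, spanned (split_family d b acyclic_family) x.
Proof.
move=> nE bE tot x; apply: spanned_trans (tot x) => -[Q k] {x}; rewrite /total_family /=.
rewrite /pbasis nth_cat -nE; case: ltnP => [ltk|lek].
  have := SpannedB (split_family d b acyclic_family) (inl (Q, Ordinal ltk)).
  by rewrite /= bE.
rewrite nth_cat; case: ltnP => [ltk|lek'].
  exact: (SpannedB (split_family d b acyclic_family) (inr (inl (Q, Ordinal ltk)))).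
have ltk : (k - n - size pacyc < 14)%N.
  have : (k < n + (size pacyc + 14))%N by rewrite nE; apply: ltn_ord.
  by rewrite -ltn_subLR // -ltn_subLR.
rewrite (nth_map [::]) // pdiffE.
have := SpannedB (split_family d b acyclic_family) (inr (inr (Q, Ordinal ltk))).
rewrite /= d_eprodM => /(SpannedZ ((-1) ^+ size (enum Q))).
by rewrite scalerA -exprMn mulrNN mulr1 expr1n scale1r.
Qed.

End Derivation.

End Evaluation.

(** * Cohomology of the May complex *)

Section MayComplex.
Variable p : nat.
Local Notation E := (extalg p).

Definition hletter (i : nat) : E := gmono p (inZp (i %/ 4), inZp i).
Local Notation peval := (peval hletter).

Lemma hletterC i j : hletter i * hletter j = - (hletter j * hletter i).
Proof. exact: gmonoC. Qed.

Lemma hletter_sq i : hletter i * hletter i = 0.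
Proof. exact: gmono_sq. Qed.

Lemma hletter_gidx s : hletter (gidx s) = gmono p s.
Proof.
case: s => a j; rewrite /hletter /gidx /= mulnC divnMDl // divn_small // addn0.
congr (gmono p (_, _)); apply: val_inj => /=; first by rewrite modn_small.
by rewrite modnMDl modn_small.
Qed.

Lemma gidx_lt12 s : (gidx s < 12)%N.
Proof.
case: s => a j; rewrite /gidx /=.
have lea : (4 * a <= 8)%N by apply: (leq_mul (leqnn 4) (_ : a <= 2)%N); rewrite -ltnS.
by apply: (leq_ltn_trans (leq_add lea (leqnn j))); rewrite (ltn_add2l 8 j 4).
Qed.

Lemma inZp4D (j k : nat) : inZp (j + k) = inZp j + inZp k :> 'I_4.
Proof. by apply: val_inj; rewrite /= modnDm. Qed.

Lemma hletter2 j : hletter (j %% 4) = gmono p (0, inZp j).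
Proof. exact: (hletter_gidx (0, inZp j)). Qed.

Lemma hletter3 j : hletter (4 + j %% 4) = gmono p (1, inZp j).
Proof. exact: (hletter_gidx (1, inZp j)). Qed.

Lemma hletter4 j : hletter (8 + j %% 4) = gmono p (2, inZp j).
Proof. exact: (hletter_gidx (2, inZp j)). Qed.

Lemma peval_letter i : peval [:: (false, [:: i])] = hletter i.
Proof. by rewrite peval1 teval_word /weval big_seq1. Qed.

Lemma dletterE i : peval (dletter i) = ext_dgen p (inZp (i %/ 4), inZp i).
Proof.
rewrite ext_dgenE /dletter /= -val_eqE /=.
case: eqP => _; last exact: peval_nil.
rewrite peval1 /teval /weval scaleN1r big_cons big_seq1 !hletter2.
by rewrite inZp4D; congr (- (_ * gmono p (_, _ + _))); apply: val_inj.
Qed.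

Lemma dext_hletterM i x :
  dext (hletter i * x) = peval (dletter i) * x - hletter i * dext x.
Proof. by rewrite dletterE; apply: dext_gmonoM. Qed.

Lemma hletter_ind (P : E -> Prop) :
    P 1 -> (forall x y, P x -> P y -> P (x + y)) ->
    (forall (c : 'F_p) x, P x -> P (c *: x)) ->
    (forall i x, (i < 12)%N -> P x -> P (hletter i * x)) ->
  forall x, P x.
Proof.
move=> P1 PD PZ PM; apply: mono_ind => // s x Px.
by rewrite -hletter_gidx; apply: PM (gidx_lt12 s) Px.
Qed.

Lemma h2E j : peval (ph2 j) = h2 p (inZp j).
Proof. by rewrite peval_letter hletter2. Qed.

Lemma h3E j : peval (ph3 j) = h3 p (inZp j).
Proof. by rewrite peval_letter hletter3. Qed.

Lemma h4E j : peval (ph4 j) = h4 p (inZp j).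
Proof. by rewrite peval_letter hletter4. Qed.

Lemma inZp4_nat n : inZp n = n%:R :> 'I_4.
Proof. by apply: val_inj; rewrite -Zp_nat. Qed.

Lemma egE i : eg hletter i = egen p i.
Proof.
rewrite /eg /pegen /egen; case: (i < 4)%N; first exact: h3E.
by case: (_ == _); rewrite pevalD !h4E !inZp4_nat.
Qed.

Lemma emonE Q : emon p Q = \prod_(i <- enum Q) eg hletter i.
Proof.
rewrite /emon; elim: (enum Q) => [|i s IHs] /=; first by rewrite big_nil.
by rewrite big_cons IHs egE.
Qed.

Lemma eeE j : peval (pe j) = ee p (inZp j).
Proof. by rewrite pevalM !h2E inZp4D inZp4_nat. Qed.

Lemma gE j : peval (pg j) = g p (inZp j).
Proof. by rewrite pevalM h4E h2E. Qed.

Lemma enum_ord4 : enum 'I_4 = [seq inZp j | j <- iota 0 4].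
Proof. by apply: (inj_map val_inj); rewrite val_enum_ord. Qed.

(** Both lists consist of the same eleven blocks in the same order, which are compared one at a
    time. *)
Lemma alephE : aleph p = [seq peval P | P <- paleph].
Proof.
have peval_mul P Q : peval (pmul P Q) = emul p (peval P) (peval Q) by rewrite pevalM.
have ord01 : [:: 0; 1] = [seq inZp j | j <- iota 0 2] :> seq 'I_4.
  by rewrite /= !inZp4_nat.
have last_class : peval (pmul (pmul (pe 0) (pg 2)) (pg 3)) =
    emul p (emul p (ee p 0) (g p 2)) (g p 3).
  by rewrite peval_mul (peval_mul (pe 0)) eeE !gE !inZp4_nat.
rewrite /aleph enum_ord4 ord01 /paleph !map_cat -!map_comp.
have shift k (j : nat) : inZp (j + k) = inZp j + k%:R :> 'I_4.
  by rewrite inZp4D (inZp4_nat k).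
have one : peval [:: (false, [::])] = eone p by rewrite peval1 teval_word /weval big_nil.
rewrite [map _ [:: [:: _]]]/= one; congr (_ ++ _).
congr (_ ++ _); first by apply: eq_map => j; rewrite /= h2E.
congr (_ ++ _); first by apply: eq_map => j; rewrite /= eeE.
congr (_ ++ _); first by apply: eq_map => j; rewrite /= gE.
congr (_ ++ _); first by apply: eq_map => j; rewrite /= peval_mul h2E gE shift.
congr (_ ++ _); first by apply: eq_map => j; rewrite /= peval_mul h2E gE shift.
congr (_ ++ _); first by apply: eq_map => j; rewrite /= peval_mul h2E gE shift.
congr (_ ++ _); first by apply: eq_map => j; rewrite /= peval_mul !gE shift.
congr (_ ++ _); first by apply: eq_map => j; rewrite /= peval_mul eeE gE shift.
congr (_ ++ _); first apply: eq_map => j.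
  by rewrite /= peval_mul (peval_mul (ph2 j)) h2E !gE !shift.
exact: (congr1 (fun x => [:: x]) (esym last_class)).
Qed.

Lemma size_alephE : size (aleph p) = size paleph.
Proof. by rewrite alephE size_map. Qed.

Lemma ecfamilyE x :
  ecfamily p x = (\prod_(i <- enum x.1) eg hletter i) * peval (nth [::] paleph x.2).
Proof.
case: x => Q k; rewrite /ecfamily emonE /=; have := ltn_ord k; move: (k : nat) => n.
by rewrite size_alephE => ltn; rewrite alephE (nth_map [::]).
Qed.

Lemma dim_extalg : dim E = (2 ^ 12)%N.
Proof.
have -> : dim E = (#|{set gen}| * 1)%N by [].
by rewrite muln1 -cardsT -powersetT card_powerset cardsT card_prod !card_ord.
Qed.

Lemma ecfamily_cohom_basis : cohom_basis p _ (ecfamily p).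
Proof.
have dbase x : dext (ecfamily p x) = 0.
  rewrite ecfamilyE (d_eprodM hletterC hletter_sq (dext1 p) dext_hletterM).
  by rewrite (d_paleph hletterC hletter_sq (dext1 p) dext_hletterM) mulr0 scaler0.
have total := total_family_spans hletterC hletter_sq hletter_ind.
have span := split_family_spans hletterC hletter_sq (dext1 p) dext_hletterM
  size_alephE ecfamilyE total.
have [|indep gen_coh] := cohomology_basis (@dextK p) dbase span.
  (* The count 64 * 36 + 2 * (64 * 14) equals 2^12. *)
  rewrite dim_extalg !card_prod !card_ord size_alephE -cardsT -powersetT.
  by rewrite card_powerset cardsT card_ord.
have sumE (c : _ -> 'F_p) :
    \sum_i escale p (c i) (ecfamily p i) = \sum_i c i *: (ecfamily p i : E).
  by apply: eq_bigr => i _; rewrite escaleE.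
split=> [x|c [y cy]|z dz].
- exact: dbase.
- by apply: indep; exists y; rewrite -sumE.
- by have [c [y zE]] := gen_coh z dz; exists c, y; rewrite sumE.
Qed.

(** With an explicit primitive [Q], a relation for all [i] reduces to four comparisons of words. *)
Lemma pdiff_coboundary (P Q : nat -> seq term) :
    all (fun j => peq (P j) (pdiff (Q j))) (iota 0 4) ->
  forall i : 'I_4, coboundary p (peval (P i)).
Proof.
move=> /allP PQ i; exists (peval (Q i)).
have {}PQ : peq (P i) (pdiff (Q i)) by apply: PQ; rewrite mem_iota /=.
rewrite (peqP hletterC hletter_sq PQ).
exact: (pdiffE (dext1 p) dext_hletterM).
Qed.

Lemma inZp4_ordD (i : 'I_4) n : inZp (i + n) = i + n%:R :> 'I_4.
Proof. by rewrite inZp4D valZpK inZp4_nat. Qed.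

Lemma h2_h2_coboundary i : coboundary p (emul p (h2 p i) (h2 p (i + 2))).
Proof.
rewrite -(inZp4_ordD i 2) -{1}[i]valZpK -!h2E emulE -pevalM.
(* The primitive is -h_{4,i}. *)
by apply: (pdiff_coboundary (P := fun i => pmul (ph2 i) (ph2 (i + 2)))
  (Q := fun i => map tneg (ph4 i))); vm_compute.
Qed.

Lemma h2_g_coboundary i :
  coboundary p (emul p (h2 p i) (g p (i + 2)) - emul p (h2 p (i + 2)) (g p i)).
Proof.
have -> : emul p (h2 p i) (g p (i + 2)) - emul p (h2 p (i + 2)) (g p i) =
    peval (pmul (ph2 i) (pg (i + 2)) ++ map tneg (pmul (ph2 (i + 2)) (pg i))).
  by rewrite pevalD pevalN !(pevalM hletter (ph2 _)) !h2E !gE inZp4_ordD valZpK.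
(* The primitive is h_{4,i} h_{4,i+2}: each of its two factors contributes one of the two
   products. *)
by apply: (pdiff_coboundary
  (P := fun i => pmul (ph2 i) (pg (i + 2)) ++ map tneg (pmul (ph2 (i + 2)) (pg i)))
  (Q := fun i => pmul (ph4 i) (ph4 (i + 2)))); vm_compute.
Qed.

Lemma h2_g_g_coboundary i :
  coboundary p (emul p (emul p (h2 p i) (g p (i + 2))) (g p (i + 3))
                - emul p (emul p (h2 p (i + 2)) (g p (i + 3))) (g p i)).
Proof.
pose P j := pmul (pmul (ph2 j) (pg (j + 2))) (pg (j + 3))
  ++ map tneg (pmul (pmul (ph2 (j + 2)) (pg (j + 3))) (pg j)).
have -> : emul p (emul p (h2 p i) (g p (i + 2))) (g p (i + 3))
    - emul p (emul p (h2 p (i + 2)) (g p (i + 3))) (g p i) = peval (P i).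
  rewrite pevalD pevalN !(pevalM hletter (pmul _ _)) !(pevalM hletter (ph2 _)).
  by rewrite !h2E !gE !inZp4_ordD valZpK.
(* The preceding primitive is multiplied by the cycle g_{i+3}, which has even degree and so commutes
   with g_i. *)
by apply: (pdiff_coboundary (P := P)
  (Q := fun i => pmul (pmul (ph4 i) (ph4 (i + 2))) (pg (i + 3)))); vm_compute.
Qed.

End MayComplex.

Theorem theorem5p7 (p : nat) (p_prime : prime p) (p_gt3 : (3 < p)%N) :
  cohom_basis p _ (ecfamily p) /\
  (forall i : 'I_4,
     [/\ coboundary p (emul p (h2 p i) (h2 p (i + 2))),
         coboundary p (emul p (h2 p i) (g p (i + 2)) - emul p (h2 p (i + 2)) (g p i))
       & coboundary p (emul p (emul p (h2 p i) (g p (i + 2))) (g p (i + 3))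
                       - emul p (emul p (h2 p (i + 2)) (g p (i + 3))) (g p i))]).
Proof.
split=> [|i]; first exact: ecfamily_cohom_basis.
by split; [exact: h2_h2_coboundary | exact: h2_g_coboundary | exact: h2_g_g_coboundary].
Qed.
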